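(* Let $\mathfrak n_4$ be the 4-dimensional indecomposable non-abelian nilpotent Lie algebra. On $\mathfrak n_4$, up to equivalence (scaling and isomorphism), the only non-classical generalized nilsolitons are the following, in an orthonormal basis $\{e_1,\dots,e_4\}$: (1) $\mu(e_1,e_2)=e_3$, $\mu(e_1,e_3)=\frac{\sqrt3}2e_4$, $H=\frac{\sqrt3}2e^{134}$, $\lambda=-\frac32$, $D=\operatorname{diag}\left(\frac14,1,\frac54,\frac32\right)$; (2) $\mu(e_1,e_2)=e_3$, $\mu(e_1,e_3)=e_4$, $H=e^{234}$, $\lambda=-\frac32$, $D=\operatorname{diag}\left(\frac12,\frac12,1,\frac32\right)$.
   Context: $\mathfrak n_4$ has a basis with nonzero brackets $[x_1,x_2]=x_3$, $[x_1,x_3]=x_4$. A triple $(\mu,g,H)$ consists of a nilpotent Lie bracket $\mu$ on a finite-dimensional real vector space $\mathfrak g$, an inner product $g$ on $\mathfrak g$, and a 3-form $H\in\Lambda^3\mathfrak g^*$ with $\mathrm d_\mu H=0$ (Chevalley–Eilenberg differential). It is a generalized nilsoliton if there exist $\lambda\in\mathbb R$ and $D\in\operatorname{Der}(\mathfrak g,\mu)$ with $$\operatorname{Ric}^B_{\mu,H}=\lambda\operatorname{Id}+D,\qquad\Delta_\mu H=\lambda H+\rho(\operatorname{Ric}^B_{\mu,H})H .$$ Here $\operatorname{Ric}^B_{\mu,H}=\operatorname{Ric}_\mu-\frac14g^{-1}H^2$, $\operatorname{Ric}_\mu$ is the Ricci endomorphism of the left-invariant metric $g$ on the simply connected Lie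 group of $(\mathfrak g,\mu)$, $H^2(X,Y)=\sum_{i,j}H(X,e_i,e_j)H(Y,e_i,e_j)$ in an orthonormal basis, $\Delta_\mu H=-\mathrm d_\mu\mathrm d_\mu^*H$ with $\mathrm d_\mu^*$ the usual codifferential, and $(\rho(A)H)(X,Y,Z)=-H(AX,Y,Z)-H(X,AY,Z)-H(X,Y,AZ)$. It is non-classical if $H\ne0$. Two triples are equivalent if there are a Lie algebra isomorphism $\varphi$, $c>0$ and $\epsilon\in\{1,-1\}$ with $\varphi^*g'=cg$, $\varphi^*H'=\epsilon cH$. The constants $\lambda,D$ are those of the listed representatives. $e^{ijk}=e^i\wedge e^j\wedge e^k$. *)

(* Defs.v *)
From HB Require Import structures.
From mathcomp Require Import all_boot all_order all_algebra.
From mathcomp Require Import sesquilinear ring.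
From mathcomp Require Import reals.

Set Implicit Arguments.
Unset Strict Implicit.
Unset Printing Implicit Defensive.

Import Order.TTheory GRing.Theory Num.Theory.
Local Open Scope ring_scope.

Section LieAlgebra.
Variables (R : realType) (V : vectType R).
Implicit Types (mu : V -> V -> V) (al : V -> V -> R) (H : V -> V -> V -> R).

(* Bilinearity is part of the type [{bilinear V -> V -> V}] used for brackets
   in [is_triple]. *)
Definition is_lie_bracket mu : Prop :=
  (forall x, mu x x = 0) /\
  (forall x y z, mu x (mu y z) + mu y (mu z x) + mu z (mu x y) = 0).

Fixpoint lower_central mu (k : nat) : {vspace V} :=
  if k is k'.+1 then
    <<[seq mu x y | x <- vbasis {:V}, y <- vbasis (lower_central mu k')]>>%VS
  else {:V}%VS.

Definition is_nilpotent mu : Prop := exists k, lower_central mu k = 0%VS.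

Definition is_derivation mu (D : V -> V) : Prop :=
  linear D /\ forall x y, D (mu x y) = mu (D x) y + mu x (D y).

Definition is_n4 mu : Prop :=
  exists x1 x2 x3 x4 : V,
    basis_of {:V} [:: x1; x2; x3; x4] /\
    [/\ mu x1 x2 = x3, mu x1 x3 = x4, mu x1 x4 = 0
      & [/\ mu x2 x3 = 0, mu x2 x4 = 0 & mu x3 x4 = 0]].

Definition is_three_form H : Prop :=
  [/\ forall y z, scalar (fun x => H x y z),
      forall x z, scalar (fun y => H x y z),
      forall x y, scalar (fun z => H x y z),
      forall x z, H x x z = 0
    & forall x y, H x y y = 0].

(* Chevalley-Eilenberg differential on 2-forms and on 3-forms:
   (d w)(x_0,...,x_k)
     = \sum_(i < j) (-1)^(i + j) w ([x_i, x_j], ..., ^x_i, ..., ^x_j, ...). *)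
Definition ce_d2 mu al (x y z : V) : R :=
  - al (mu x y) z + al (mu x z) y - al (mu y z) x.

Definition ce_d3 mu H (x y z t : V) : R :=
  - H (mu x y) z t + H (mu x z) y t - H (mu x t) y z
  - H (mu y z) x t + H (mu y t) x z - H (mu z t) x y.

Definition rho (A : V -> V) H (x y z : V) : R :=
  - H (A x) y z - H x (A y) z - H x y (A z).

End LieAlgebra.

Section Curvature.
Variables (R : realType) (V : vectType R).
Variables (mu : V -> V -> V) (g : {dot V for idfun}).

Definition orthonormal_basis (e : seq V) : Prop :=
  basis_of {:V} e /\ orthonormal g e.

(* In the rest of this section [e] is meant to be an orthonormal basis; none of
   the resulting objects depends on which one is used. *)
Variable e : seq V.

(* The endomorphism [g^-1 b], i.e. g (raise b x, y) = b (x, y). *)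
Definition raise (b : V -> V -> R) (x : V) : V := \sum_(u <- e) b x u *: u.

(* Levi-Civita connection of the left-invariant metric, on left-invariant
   vector fields (Koszul formula). *)
Definition nabla (x y : V) : V :=
  raise (fun y' z => 2^-1 * (g (mu x y') z - g (mu y' z) x + g (mu z x) y')) y.

Definition curvature (x y z : V) : V :=
  nabla x (nabla y z) - nabla y (nabla x z) - nabla (mu x y) z.

(* Trace of z |-> curvature z x y. *)
Definition ricci (x y : V) : R := \sum_(u <- e) g (curvature u x y) u.

Definition form_square (H : V -> V -> V -> R) (x y : V) : R :=
  \sum_(u <- e) \sum_(v <- e) H x u v * H y u v.

Definition ricci_B (H : V -> V -> V -> R) (x : V) : V :=
  raise ricci x - 4^-1 *: raise (form_square H) x.

(* (d^* H)(y, z) = - \sum_u (nabla_u H)(u, y, z), where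
   (nabla_u H)(x, y, z)
     = - H (nabla u x, y, z) - H (x, nabla u y, z) - H (x, y, nabla u z)
   because H is left-invariant. *)
Definition codiff (H : V -> V -> V -> R) (y z : V) : R :=
  - \sum_(u <- e)
      (- H (nabla u u) y z - H u (nabla u y) z - H u y (nabla u z)).

Definition laplacian (H : V -> V -> V -> R) (x y z : V) : R :=
  - ce_d2 mu (codiff H) x y z.

End Curvature.

Section GeneralizedNilsolitons.
Variables (R : realType) (V : vectType R).
Variables (mu : {bilinear V -> V -> V}) (g : {dot V for idfun}).
Variable H : V -> V -> V -> R.

(* The inner product [g] needs no further axiom: its type makes it symmetric
   and positive definite. *)
Definition is_triple : Prop :=
  [/\ is_lie_bracket mu, is_nilpotent mu, is_three_form H
    & forall x y z t, ce_d3 mu H x y z t = 0].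

Definition nilsoliton_with (lam : R) (D : V -> V) : Prop :=
  is_derivation mu D /\
  exists e : seq V,
    [/\ orthonormal_basis g e,
        forall x, ricci_B mu g e H x = lam *: x + D x
      & forall x y z, laplacian mu g e H x y z =
          lam * H x y z + rho (ricci_B mu g e H) H x y z].

Definition generalized_nilsoliton : Prop :=
  exists (lam : R) (D : V -> V), nilsoliton_with lam D.

Definition non_classical : Prop := exists x y z, H x y z <> 0.

End GeneralizedNilsolitons.

Definition equivalent_triples (R : realType) (V V' : vectType R)
    (mu : {bilinear V -> V -> V}) (g : {dot V for idfun})
    (H : V -> V -> V -> R)
    (mu' : {bilinear V' -> V' -> V'}) (g' : {dot V' for idfun})
    (H' : V' -> V' -> V' -> R) : Prop :=
  exists (phi : {linear V -> V'}) (c eps : R),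
    [/\ bijective phi,
        forall x y, phi (mu x y) = mu' (phi x) (phi y),
        0 < c /\ (eps = 1 \/ eps = - 1),
        forall x y, g' (phi x) (phi y) = c * g x y
      & forall x y z, H' (phi x) (phi y) (phi z) = eps * c * H x y z].

Section Models.
Variable R : realType.
Local Notation V4 := 'rV[R]_4.

(* Standard basis and dual basis of R^4, indexed by k = 1, ..., 4. *)
Definition evec (k : nat) : V4 := delta_mx 0 (inord k.-1).
Definition ecov (k : nat) (x : V4) : R := x 0 (inord k.-1).

(* e^{ij} and e^{ijk}, with (e^{ijk}) (e_i, e_j, e_k) = 1. *)
Definition ecov2 (i j : nat) (x y : V4) : R :=
  ecov i x * ecov j y - ecov j x * ecov i y.
Definition ecov3 (i j k : nat) (x y z : V4) : R :=
  \det (\matrix_(a < 3, b < 3)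
          ecov (nth 0%N [:: i; j; k] a) (nth 0 [:: x; y; z] b)).

(* [e_1, e_2] = e_3, [e_1, e_3] = c e_4. *)
Definition n4_bracket (c : R) (x y : V4) : V4 :=
  ecov2 1 2 x y *: evec 3 + (ecov2 1 3 x y * c) *: evec 4.

Lemma ecov2_linearl i j (a : R) (x x' y : V4) :
  ecov2 i j (a *: x + x') y = a * ecov2 i j x y + ecov2 i j x' y.
Proof. by rewrite /ecov2 /ecov !mxE; ring. Qed.

Lemma ecov2_linearr i j (a : R) (x y y' : V4) :
  ecov2 i j x (a *: y + y') = a * ecov2 i j x y + ecov2 i j x y'.
Proof. by rewrite /ecov2 /ecov !mxE; ring. Qed.

Lemma n4_bracket_bilinear c : bilinear_for *:%R *:%R (n4_bracket c).
Proof.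
have comb (a p p' q q' : R) (u v : V4) :
    (a * p + p') *: u + ((a * q + q') * c) *: v
      = a *: (p *: u + (q * c) *: v) + (p' *: u + (q' * c) *: v).
  by rewrite mulrDl !scalerDl -mulrA -!(scalerA a) addrACA -scalerDr.
by split=> y a x x'; rewrite /n4_bracket -comb !(ecov2_linearl, ecov2_linearr).
Qed.

HB.instance Definition _ c :=
  bilinear_isBilinear.Build R V4 V4 V4 *:%R *:%R (n4_bracket c)
    (n4_bracket_bilinear c).

Definition std_dot (x y : V4) : R := \sum_(i < 4) x 0 i * y 0 i.

Lemma std_dot_bilinear : bilinear_for *%R (idfun \; *%R) std_dot.
Proof.
split=> y a x x' /=; rewrite /std_dot mulr_sumr -big_split /=;
  by apply: eq_bigr => i _; rewrite !mxE; ring.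
Qed.

HB.instance Definition _ :=
  bilinear_isBilinear.Build R V4 V4 R *%R (idfun \; *%R) std_dot
    std_dot_bilinear.

Lemma std_dot_sym x y : std_dot x y = (-1) ^+ false * idfun (std_dot y x).
Proof.
by rewrite expr0 mul1r; apply: eq_bigr => i _; rewrite mulrC.
Qed.

HB.instance Definition _ :=
  isHermitianSesquilinear.Build R V4 false idfun std_dot std_dot_sym.

Lemma std_dot_gt0 x : x != 0 -> 0 < std_dot x x.
Proof.
move=> x_neq0; rewrite lt0r sumr_ge0 ?andbT => [|i _]; last exact: sqr_ge0.
apply: contra_neq x_neq0 => /eqP; rewrite psumr_eq0 => [/allP x0|i _];
  last exact: sqr_ge0.
apply/rowP => i; rewrite mxE; apply/eqP.
by have := x0 i (mem_index_enum i); rewrite /= mulf_eq0 orbb.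
Qed.

HB.instance Definition _ := isDotProduct.Build R V4 std_dot std_dot_gt0.

Definition diag4 (d1 d2 d3 d4 : R) (x : V4) : V4 :=
  d1 * ecov 1 x *: evec 1 + d2 * ecov 2 x *: evec 2 +
  d3 * ecov 3 x *: evec 3 + d4 * ecov 4 x *: evec 4.

Definition model1_bracket : {bilinear V4 -> V4 -> V4} :=
  n4_bracket (Num.sqrt 3 / 2).
Definition model1_form (x y z : V4) : R :=
  Num.sqrt 3 / 2 * ecov3 1 3 4 x y z.

Definition model2_bracket : {bilinear V4 -> V4 -> V4} := n4_bracket 1.
Definition model2_form (x y z : V4) : R := ecov3 2 3 4 x y z.

Definition std_metric : {dot V4 for idfun} := std_dot.

End Models.

Arguments model1_bracket {R}.
Arguments model1_form {R}.
Arguments model2_bracket {R}.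
Arguments model2_form {R}.
Arguments std_metric {R}.

(* Main.v *)
Require Import Defs.
From HB Require Import structures.
From mathcomp Require Import all_boot all_order all_algebra.
From mathcomp Require Import sesquilinear ring lra.
From mathcomp Require Import boolp reals.

(* Gram-Schmidt along the flag [<x4> < <x3, x4> < <x2, x3, x4>] gives an
   orthonormal basis with [f1, f2] = a f3 + b f4, [f1, f3] = c f4, a, c > 0, and
   H = h1 f^234 + h2 f^134 + h3 f^124 + h4 f^123.  A derivation preserves this
   characteristic flag, and D = Ric^B - lam is symmetric, so D is diagonal.  The
   vanishing of the off-diagonal entries of Ric^B forces b = 0 and leaves
   exactly one nonzero h_i.  What remains are the equations d1 + d2 = d3 and
   d1 + d3 = d4 on the eigenvalues of D, and the Laplace equation: for i = 3, 4
   they make a sum of positive terms vanish, for i = 1 they give c = a,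
   h1^2 = a^2 (model 2), and for i = 2 they give 4 c^2 = 3 a^2, h2^2 = c^2
   (model 1).  The models are inequivalent because an isomorphism preserves the
   ideal <e2, e3, e4>, on which only the second form is nonzero. *)

Set Implicit Arguments.
Unset Strict Implicit.
Unset Printing Implicit Defensive.

Import Order.TTheory GRing.Theory Num.Theory.
Local Open Scope ring_scope.

(** * Inner products and expansions in orthonormal bases *)

Section Dot.
Variables (R : realType) (V : vectType R) (g : {dot V for idfun}).
Implicit Types (e s : seq V) (u v w x y z : V).

Lemma dotC x y : g x y = g y x.
Proof. by rewrite [LHS](@hermC _ false idfun _ g) expr0 mul1r. Qed.

Lemma dotDl x y z : g (x + y) z = g x z + g y z.
Proof. exact: linearDl. Qed.

Lemma dotZl a x z : g (a *: x) z = a * g x z.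
Proof. exact: linearZl_LR. Qed.

Lemma dotDr x y z : g z (x + y) = g z x + g z y.
Proof. by rewrite dotC dotDl !(dotC z). Qed.

Lemma dotZr a x z : g z (a *: x) = a * g z x.
Proof. by rewrite dotC dotZl dotC. Qed.

Lemma dot0l z : g 0 z = 0.
Proof. by rewrite -(scale0r 0) dotZl mul0r. Qed.

Lemma dot0r z : g z 0 = 0.
Proof. by rewrite dotC dot0l. Qed.

Lemma dotNl x z : g (- x) z = - g x z.
Proof. by rewrite -scaleN1r dotZl mulN1r. Qed.

Lemma dotNr x z : g z (- x) = - g z x.
Proof. by rewrite dotC dotNl dotC. Qed.

Definition dotE := (dotDl, dotDr, dotZl, dotZr, dot0l, dot0r, dotNl, dotNr).

Lemma dot_sumr I (r : seq I) (F : I -> V) z :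
  g z (\sum_(i <- r) F i) = \sum_(i <- r) g z (F i).
Proof.
by elim: r => [|i r IHr]; rewrite ?big_nil ?dot0r // !big_cons dotDr IHr.
Qed.

Lemma dot_suml I (r : seq I) (F : I -> V) z :
  g (\sum_(i <- r) F i) z = \sum_(i <- r) g (F i) z.
Proof. by rewrite dotC dot_sumr; under eq_bigr do rewrite dotC. Qed.

Lemma dot_eq0 x : g x x = 0 -> x = 0.
Proof.
move=> gx0; apply/eqP/negPn/negP => /(@neq0_dnorm_gt0 _ _ _ g).
by rewrite gx0 ltxx.
Qed.

Lemma dot_inj x y : (forall z, g x z = g y z) -> x = y.
Proof.
move=> gxy; apply/eqP; rewrite -subr_eq0; apply/eqP/dot_eq0.
by rewrite dotDl dotNl gxy subrr.
Qed.

Lemma orthonormal_cons u s :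
  orthonormal g (u :: s) =
  [&& g u u == 1, all (fun v => g u v == 0) s & orthonormal g s].
Proof. by rewrite /orthonormal /= -!andbA; do !bool_congr. Qed.

Lemma orthonormal_expand s v :
  orthonormal g s -> v \in <<s>>%VS -> v = \sum_(u <- s) g v u *: u.
Proof.
elim: s v => [|u s IHs] v.
  by rewrite span_nil memv0 big_nil => _ /eqP.
rewrite orthonormal_cons span_cons => /and3P[/eqP guu /allP gus os].
case/memv_addP => _ /vlineP[k ->] [w sw ->].
have gwu : g w u = 0.
  rewrite (IHs w os sw) dot_suml big_seq big1 // => x /gus /eqP gux.
  by rewrite dotZl (dotC x) gux mulr0.
rewrite big_cons dotDl dotZl guu gwu mulr1 addr0; congr (_ + _).
rewrite {1}(IHs w os sw); apply: eq_big_seq => x /gus /eqP gux.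
by rewrite dotDl dotZl gux mulr0 add0r.
Qed.

Lemma basis_expand e v : orthonormal_basis g e -> v = \sum_(u <- e) g v u *: u.
Proof.
case=> be oe; apply: orthonormal_expand => //.
by rewrite (span_basis be) memvf.
Qed.

Lemma linear_sumP (W : lmodType R) (f : V -> W) (c : V -> R) s :
  linear f -> f (\sum_(u <- s) c u *: u) = \sum_(u <- s) c u *: f u.
Proof.
move=> lf; elim: s => [|u s IHs]; last by rewrite !big_cons lf IHs.
(* [linear f] is an unbundled hypothesis here, so [f 0 = 0] is extracted from it at the scalar
   [-1]. *)
rewrite !big_nil; have := lf (-1) 0 0.
by rewrite scaleN1r addNr scaleN1r addNr.
Qed.

(** Expanding one copy of each [u] in [e'] gives a double sum with symmetric weights [g u v];
    summing over [u] first then reassembles the trace over [e']. *)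
Lemma trace_indep (W : lmodType R) (B : V -> V -> W) e e' :
  orthonormal_basis g e -> orthonormal_basis g e' ->
  (forall y, linear (B ^~ y)) -> (forall x, linear (B x)) ->
  \sum_(u <- e) B u u = \sum_(u <- e') B u u.
Proof.
move=> ob ob' Bl Br.
transitivity (\sum_(u <- e) \sum_(v <- e') g u v *: B u v).
  apply: eq_bigr => u _; by rewrite -linear_sumP // -(basis_expand _ ob').
rewrite exchange_big /=; apply: eq_bigr => v _.
under eq_bigr do rewrite dotC.
by rewrite -(@linear_sumP W (B ^~ v)) //= -(basis_expand _ ob).
Qed.

Lemma trace_indep_scalar (B : V -> V -> R) e e' :
  orthonormal_basis g e -> orthonormal_basis g e' ->
  (forall y, scalar (B ^~ y)) -> (forall x, scalar (B x)) ->
  \sum_(u <- e) B u u = \sum_(u <- e') B u u.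
Proof. exact: (@trace_indep R^o). Qed.

End Dot.

(** * Independence of curvature, codifferential and Laplacian from the orthonormal basis *)

Section Independence.
Variables (R : realType) (V : vectType R).
Variables (mu : {bilinear V -> V -> V}) (g : {dot V for idfun}).
Implicit Types (x y z u v w : V).

Lemma brDl x y z : mu (x + y) z = mu x z + mu y z.
Proof. exact: linearDl. Qed.
Lemma brDr x y z : mu z (x + y) = mu z x + mu z y.
Proof. exact: linearDr. Qed.
Lemma brZl a x z : mu (a *: x) z = a *: mu x z.
Proof. exact: linearZl_LR. Qed.
Lemma brZr a x z : mu z (a *: x) = a *: mu z x.
Proof. exact: linearZr_LR. Qed.
Definition brE := (brDl, brDr, brZl, brZr).

Lemma dot_raise e (b : V -> V -> R) x z : orthonormal_basis g e ->
  scalar (b x) -> g (raise e b x) z = b x z.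
Proof.
move=> ob lb; rewrite /raise dot_suml {2}(basis_expand z ob).
rewrite (@linear_sumP _ _ R^o (b x)) //=; apply: eq_bigr => u _.
by rewrite dotZl mulrC dotC.
Qed.

(** The value of g(nabla_x y, z), written without any basis; by nondegeneracy of [g] this determines
    [nabla]. *)
Definition koszul x y z : R :=
  2^-1 * (g (mu x y) z - g (mu y z) x + g (mu z x) y).

Lemma koszul_linear x y : scalar (koszul x y).
Proof. by move=> a z z'; rewrite /koszul !brE !dotE; ring. Qed.

Lemma dot_nabla e x y z : orthonormal_basis g e ->
  g (nabla mu g e x y) z = koszul x y z.
Proof.
move=> ob; rewrite /nabla (@dot_raise _ (fun y' z => koszul x y' z)) //.
exact: koszul_linear.
Qed.

Variables (e e' : seq V).
Hypotheses (ob : orthonormal_basis g e) (ob' : orthonormal_basis g e').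

Lemma raise_indep (b : V -> V -> R) x : scalar (b x) ->
  raise e b x = raise e' b x.
Proof. by move=> lb; apply: (@dot_inj _ _ g) => z; rewrite !dot_raise. Qed.

Lemma nabla_indep : nabla mu g e = nabla mu g e'.
Proof.
by apply/funext => x; apply/funext => y; apply: (@dot_inj _ _ g) => z;
  rewrite !dot_nabla.
Qed.

Lemma nabla_linearl y : linear (fun x => nabla mu g e x y).
Proof.
move=> a x x'; apply: (@dot_inj _ _ g) => z.
by rewrite !dotE !dot_nabla // /koszul !brE !dotE; ring.
Qed.

Lemma nabla_linearr x : linear (nabla mu g e x).
Proof.
move=> a y y'; apply: (@dot_inj _ _ g) => z.
by rewrite !dotE !dot_nabla // /koszul !brE !dotE; ring.
Qed.

Lemma dot_curvature x y z u : g (curvature mu g e x y z) u =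
  g (nabla mu g e x (nabla mu g e y z)) u
  - g (nabla mu g e y (nabla mu g e x z)) u - g (nabla mu g e (mu x y) z) u.
Proof. by rewrite /curvature !dotE. Qed.

Lemma curvature_indep : curvature mu g e = curvature mu g e'.
Proof. by rewrite /curvature nabla_indep. Qed.

Lemma curvature_linearl x y u : scalar (fun z => g (curvature mu g e z x y) u).
Proof.
move=> a z z'; rewrite !dot_curvature !brE.
by rewrite !(nabla_linearl, nabla_linearr) !dotE; ring.
Qed.

Lemma ricci_linearr x : scalar (ricci mu g e x).
Proof.
move=> a y y'; rewrite /ricci mulr_sumr -big_split; apply: eq_bigr => u _ /=.
by rewrite !dot_curvature !(nabla_linearl, nabla_linearr) !dotE; ring.
Qed.

(** The curvature tensor does not depend on the basis, and Ricci is the trace of a form bilinear in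
    ([u], [v]). *)
Lemma ricci_indep : ricci mu g e = ricci mu g e'.
Proof.
apply/funext => x; apply/funext => y; rewrite /ricci -curvature_indep.
apply: (@trace_indep_scalar _ _ g
          (fun u v => g (curvature mu g e u x y) v)) => //.
  exact: curvature_linearl.
  by move=> u a v w /=; rewrite dotDr dotZr.
Qed.

Variable H : V -> V -> V -> R.
Hypothesis H3 : is_three_form H.

Lemma form_square_linearr x : scalar (form_square e H x).
Proof.
case: H3 => Hl _ _ _ _.
move=> a y y'; rewrite /form_square mulr_sumr -big_split.
apply: eq_bigr => u _ /=.
rewrite mulr_sumr -big_split; apply: eq_bigr => v _ /=.
by rewrite Hl; ring.
Qed.

Lemma form_square_indep : form_square e H = form_square e' H.
Proof.
case: H3 => _ Hm Hr _ _.
apply/funext => x; apply/funext => y; rewrite /form_square.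
(* The two summation bases are exchanged one at a time, each exchange being a trace of a bilinear
   form. *)
transitivity (\sum_(u <- e) \sum_(v <- e') H x u v * H y u v).
  apply: eq_bigr => u _.
  by apply: (@trace_indep_scalar _ _ g (fun v w => H x u v * H y u w)) => //
    v a w w'; rewrite Hr; ring.
by apply: (@trace_indep_scalar _ _ g
             (fun u u' => \sum_(v <- e') H x u v * H y u' v)) => // u a w w';
  rewrite mulr_sumr -big_split; apply: eq_bigr => v _ /=; rewrite Hm; ring.
Qed.

(** The soliton equations come with some orthonormal basis; this lemma and [laplacian_indep] move
    them to a frame adapted to the bracket. *)
Lemma ricci_B_indep : ricci_B mu g e H = ricci_B mu g e' H.
Proof.
apply/funext => x; rewrite /ricci_B (raise_indep (@ricci_linearr x)).
by rewrite (raise_indep (@form_square_linearr x)) ricci_indep form_square_indep.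
Qed.

Lemma codiff_indep : codiff mu g e H = codiff mu g e' H.
Proof.
case: H3 => Hl Hm Hr _ _.
apply/funext => y; apply/funext => z; rewrite /codiff -nabla_indep; congr (- _).
set N := nabla mu g e.
apply: (@trace_indep_scalar _ _ g
          (fun u v => - H (N u v) y z - H u (N v y) z - H u y (N v z))) => //
  u a v w; rewrite /N !(nabla_linearl, nabla_linearr) !(Hl, Hm, Hr); ring.
Qed.

Lemma laplacian_indep : laplacian mu g e H = laplacian mu g e' H.
Proof. by rewrite /laplacian codiff_indep. Qed.

Lemma dot_ricci_B x z :
  g (ricci_B mu g e H x) z = ricci mu g e x z - 4^-1 * form_square e H x z.
Proof.
rewrite /ricci_B !dotE (dot_raise _ ob (@ricci_linearr x)).
by rewrite (dot_raise _ ob (@form_square_linearr x)).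
Qed.

End Independence.

(** * Curvature and 3-forms in coordinates with respect to an adapted frame *)

Section Frame.
Variables (R : realType) (V : vectType R).
Variables (mu : {bilinear V -> V -> V}) (g : {dot V for idfun}).
Variables (f1 f2 f3 f4 : V) (a b c : R).

Definition coor (f x : V) : R := g x f.
Local Notation "x .:1" := (coor f1 x) (at level 2, left associativity).
Local Notation "x .:2" := (coor f2 x) (at level 2, left associativity).
Local Notation "x .:3" := (coor f3 x) (at level 2, left associativity).
Local Notation "x .:4" := (coor f4 x) (at level 2, left associativity).

Let f := [:: f1; f2; f3; f4].

(** The term [b *: f4] must be allowed: orthonormalizing a standard basis of n_4 only keeps the
    bracket triangular. *)
Definition n4_frame := forall x y,
  mu x y = (x.:1 * y.:2 - x.:2 * y.:1) *: (a *: f3 + b *: f4)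
           + (c * (x.:1 * y.:3 - x.:3 * y.:1)) *: f4.

Hypotheses (ob : orthonormal_basis g f) (muE : n4_frame).

Lemma coorD h x y : coor h (x + y) = coor h x + coor h y.
Proof. exact: dotDl. Qed.
Lemma coorZ h k x : coor h (k *: x) = k * coor h x.
Proof. exact: dotZl. Qed.
Lemma coorN h x : coor h (- x) = - coor h x.
Proof. exact: dotNl. Qed.

Lemma coor0 h : coor h 0 = 0.
Proof. exact: dot0l. Qed.

Definition coorE := (coorD, coorZ, coorN, coor0).

Lemma coor_frame :
  ((f1.:1 = 1) * (f1.:2 = 0) * (f1.:3 = 0) * (f1.:4 = 0)) *
  ((f2.:1 = 0) * (f2.:2 = 1) * (f2.:3 = 0) * (f2.:4 = 0)) *
  ((f3.:1 = 0) * (f3.:2 = 0) * (f3.:3 = 1) * (f3.:4 = 0)) *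
  ((f4.:1 = 0) * (f4.:2 = 0) * (f4.:3 = 0) * (f4.:4 = 1)).
Proof.
case: ob => _; rewrite /f !orthonormal_cons /= !andbT /coor.
rewrite (dotC g f2 f1) (dotC g f3 f1) (dotC g f4 f1).
rewrite (dotC g f3 f2) (dotC g f4 f2) (dotC g f4 f3).
case/and5P=> /eqP-> /and3P[/eqP-> /eqP-> /eqP->] /eqP-> /andP[/eqP-> /eqP->].
by case/and3P=> /eqP-> /eqP-> /eqP->.
Qed.

Lemma frame_expand x : x = x.:1 *: f1 + x.:2 *: f2 + x.:3 *: f3 + x.:4 *: f4.
Proof.
by rewrite {1}(basis_expand x ob) /f !big_cons big_nil addr0 !addrA.
Qed.

Lemma dot_coor x y :
  g x y = x.:1 * y.:1 + x.:2 * y.:2 + x.:3 * y.:3 + x.:4 * y.:4.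
Proof.
rewrite {1}(frame_expand y) !dotE /coor; ring.
Qed.

Lemma coor_mu x y :
  ((mu x y).:1 = 0) * ((mu x y).:2 = 0) *
  ((mu x y).:3 = a * (x.:1 * y.:2 - x.:2 * y.:1)) *
  ((mu x y).:4 = b * (x.:1 * y.:2 - x.:2 * y.:1)
                  + c * (x.:1 * y.:3 - x.:3 * y.:1)).
Proof.
by rewrite muE !(coorD, coorZ) !coor_frame; do !split; ring.
Qed.

Local Notation N := (nabla mu g f).

Lemma coor_nabla x y :
  ((N x y).:1 = 2^-1 * (y.:2 * (a * x.:3 + b * x.:4) + c * y.:3 * x.:4
                + x.:2 * (a * y.:3 + b * y.:4) + c * x.:3 * y.:4)) *
  ((N x y).:2 = - 2^-1 * (y.:1 * (a * x.:3 + b * x.:4)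
                + x.:1 * (a * y.:3 + b * y.:4))) *
  ((N x y).:3 = 2^-1 * (a * (x.:1 * y.:2 - x.:2 * y.:1)
                - c * y.:1 * x.:4 - c * x.:1 * y.:4)) *
  ((N x y).:4 = 2^-1 * (b * (x.:1 * y.:2 - x.:2 * y.:1)
                + c * (x.:1 * y.:3 - x.:3 * y.:1))).
Proof.
by do !split; rewrite [LHS](dot_nabla _ _ _ _ ob) /koszul !dot_coor !coor_mu
  !coor_frame; ring.
Qed.

(** The result agrees with the formula for nilpotent metric Lie algebras, Ric(x,y) = -1/2 sum_i
    g([x,f_i],[y,f_i]) + 1/4 sum_{i,j} g([f_i,f_j],x) g([f_i,f_j],y), but is obtained directly from
    the trace of the curvature. *)
Lemma ricci_coor x y : ricci mu g f x y =
  - 2^-1 * (a ^+ 2 + b ^+ 2 + c ^+ 2) * (x.:1 * y.:1)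
  - 2^-1 * (a ^+ 2 + b ^+ 2) * (x.:2 * y.:2)
  - 2^-1 * b * c * (x.:2 * y.:3 + x.:3 * y.:2)
  + 2^-1 * (a ^+ 2 - c ^+ 2) * (x.:3 * y.:3)
  + 2^-1 * a * b * (x.:3 * y.:4 + x.:4 * y.:3)
  + 2^-1 * (b ^+ 2 + c ^+ 2) * (x.:4 * y.:4).
Proof.
rewrite /ricci !big_cons big_nil addr0 !dot_curvature.
rewrite -![g _ f1]/(coor f1 _) -![g _ f2]/(coor f2 _).
rewrite -![g _ f3]/(coor f3 _) -![g _ f4]/(coor f4 _).
rewrite !coor_nabla !coor_mu !coor_frame.
by field.
Qed.

Variables (H : V -> V -> V -> R) (h1 h2 h3 h4 : R).

(** The 3-form f^i ^ f^j ^ f^k, as a 3 by 3 determinant expanded along the coordinates of [x]. *)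
Definition minor (i j k x y z : V) : R :=
  coor i x * (coor j y * coor k z - coor k y * coor j z)
  - coor j x * (coor i y * coor k z - coor k y * coor i z)
  + coor k x * (coor i y * coor j z - coor j y * coor i z).

Definition form_frame := forall x y z, H x y z =
  h1 * minor f2 f3 f4 x y z + h2 * minor f1 f3 f4 x y z
  + h3 * minor f1 f2 f4 x y z + h4 * minor f1 f2 f3 x y z.

Hypothesis HE : form_frame.

Lemma form_frame_three_form : is_three_form H.
Proof.
split=> *; try (move=> k u v /=); rewrite !HE /minor ?(coorD, coorZ); ring.
Qed.

(** In dimension four [H] is the contraction of the volume form with w = (h1, -h2, h3, -h4), hence
    H^2 = 2 (|w|^2 g - w (x) w). *)
Lemma form_square_coor x y : form_square f H x y =
  2 * ((h1 ^+ 2 + h2 ^+ 2 + h3 ^+ 2 + h4 ^+ 2)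
       * (x.:1 * y.:1 + x.:2 * y.:2 + x.:3 * y.:3 + x.:4 * y.:4)
       - (h1 * x.:1 - h2 * x.:2 + h3 * x.:3 - h4 * x.:4)
         * (h1 * y.:1 - h2 * y.:2 + h3 * y.:3 - h4 * y.:4)).
Proof.
rewrite /form_square !big_cons !big_nil !HE /minor !coor_frame.
by ring.
Qed.

Lemma coor_ricci_B x (s := h1 ^+ 2 + h2 ^+ 2 + h3 ^+ 2 + h4 ^+ 2) :
  ((ricci_B mu g f H x).:1 =
     - 2^-1 * (a ^+ 2 + b ^+ 2 + c ^+ 2 + s - h1 ^+ 2) * x.:1
     - 2^-1 * (h1 * h2) * x.:2 + 2^-1 * (h1 * h3) * x.:3
     - 2^-1 * (h1 * h4) * x.:4) *
  ((ricci_B mu g f H x).:2 =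
     - 2^-1 * (h1 * h2) * x.:1 - 2^-1 * (a ^+ 2 + b ^+ 2 + s - h2 ^+ 2) * x.:2
     - 2^-1 * (b * c + h2 * h3) * x.:3 + 2^-1 * (h2 * h4) * x.:4) *
  ((ricci_B mu g f H x).:3 =
     2^-1 * (h1 * h3) * x.:1 - 2^-1 * (b * c + h2 * h3) * x.:2
     + 2^-1 * (a ^+ 2 - c ^+ 2 - s + h3 ^+ 2) * x.:3
     + 2^-1 * (a * b - h3 * h4) * x.:4) *
  ((ricci_B mu g f H x).:4 =
     - 2^-1 * (h1 * h4) * x.:1 + 2^-1 * (h2 * h4) * x.:2
     + 2^-1 * (a * b - h3 * h4) * x.:3
     + 2^-1 * (b ^+ 2 + c ^+ 2 - s + h4 ^+ 2) * x.:4).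
Proof.
have H3 := form_frame_three_form.
by do !split; rewrite [LHS](dot_ricci_B _ ob H3) ricci_coor form_square_coor
  !coor_frame /s; field.
Qed.

Lemma codiff_coor y z : codiff mu g f H y z =
  (h3 * y.:4 + h4 * y.:3) * (a * z.:3 + b * z.:4)
  + c * (h2 * y.:4 - h4 * y.:2) * z.:4
  - (h3 * z.:4 + h4 * z.:3) * (a * y.:3 + b * y.:4)
  - c * (h2 * z.:4 - h4 * z.:2) * y.:4.
Proof.
rewrite /codiff !big_cons !big_nil !HE /minor !coor_nabla !coor_frame.
by field.
Qed.

(** A sufficient criterion, used to verify the two models. Under these vanishing conditions the
    difference of the two sides is a combination of f^234 and f^134, whose coefficients are the two
    scalar equations. *)
Lemma form_frame_laplacian lam : b = 0 -> h3 = 0 -> h4 = 0 -> h1 * h2 = 0 ->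
  2 * lam * h1 = - 3 * h1 ^+ 3 ->
  2 * lam * h2 = - (c ^+ 2 + 3 * h2 ^+ 2) * h2 ->
  forall x y z, laplacian mu g f H x y z =
    lam * H x y z + rho (ricci_B mu g f H) H x y z.
Proof.
move=> b0 h30 h40 h12 E1 E2 x y z.
rewrite /laplacian /ce_d2 !codiff_coor b0 h30 h40 /rho !HE !coor_mu.
transitivity (2^-1 * (2 * lam * h1 + 3 * h1 ^+ 3) * minor f2 f3 f4 x y z
  + 2^-1 * (2 * lam * h2 + (c ^+ 2 + 3 * h2 ^+ 2) * h2)
      * minor f1 f3 f4 x y z).
  by rewrite E1 E2; ring.
rewrite /minor !coor_ricci_B b0 h30 h40.
by move/eqP: h12; rewrite mulf_eq0 => /orP[] /eqP ->; field.
Qed.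

(** * Polynomial equations forced by the soliton conditions *)

Section Soliton.
Variables (lam : R) (D : V -> V).
Hypotheses (HD : forall x y, D (mu x y) = mu (D x) y + mu x (D y)).
Hypotheses (HR : forall x, ricci_B mu g f H x = lam *: x + D x).
Hypotheses (HL : forall x y z, laplacian mu g f H x y z =
  lam * H x y z + rho (ricci_B mu g f H) H x y z).
Hypotheses (a0 : a != 0) (c0 : c != 0).

Let coor_D h x : coor h (D x) = coor h (ricci_B mu g f H x) - lam * coor h x.
Proof. by rewrite HR coorD coorZ addrAC subrr add0r. Qed.

Let mul_eq0 (k x : R) : k != 0 -> k * x = 0 -> x = 0.
Proof. by move=> k0 /eqP; rewrite mulf_eq0 (negPf k0) => /eqP. Qed.

Ltac derive h x y :=
  have := congr1 (coor h) (HD x y);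
  rewrite coorD !coor_D !coor_ricci_B !coor_mu !coor_D !coor_ricci_B !coor_frame.

(** The six entries of [D] mapping some f_j to f_i with i < j vanish, because a derivation preserves
    the flag. By [coor_ricci_B] they are, up to a factor, the products h_i h_j, corrected by [a * b]
    and [b * c] in two cases. The order matters: some components of the derivation identity isolate
    an entry only once an earlier one is known to be zero. *)
Lemma soliton_offdiag :
  [/\ h1 * h2 = 0, h1 * h3 = 0, h1 * h4 = 0 & 
   [/\ h2 * h4 = 0, h2 * h3 = 0, h3 * h4 = 0 & b = 0]].
Proof.
have h14 : h1 * h4 = 0.
  by apply: (mul_eq0 c0); derive f4 f3 f4 => E; lra.
have h13 : h1 * h3 = 0.
  by apply: (mul_eq0 a0); derive f3 f2 f3 => E; lra.
have h12 : h1 * h2 = 0.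
  apply: (mul_eq0 c0); derive f4 f2 f3 => E.
  have : b * (h1 * h3) = 0 by rewrite h13 mulr0.
  lra.
have h24 : h2 * h4 = 0.
  by apply: (mul_eq0 a0); derive f3 f1 f4 => E; lra.
have h34 : a * b - h3 * h4 = 0.
  apply: (mul_eq0 c0); derive f4 f1 f4 => E.
  have : b * (h2 * h4) = 0 by rewrite h24 mulr0.
  lra.
have h23 : b * c + h2 * h3 = 0.
  apply: (mul_eq0 a0); derive f3 f1 f3 => E.
  have : c * (a * b - h3 * h4) = 0 by rewrite h34 mulr0.
  lra.
(* Since [h2 * h4 = 0], one of the two relations involving [b] loses its quadratic term in the
   h_i. *)
have b0 : b = 0.
  have /eqP := h24; rewrite mulf_eq0 => /orP[] /eqP h0.
    by apply: (mul_eq0 c0); rewrite mulrC -h23 h0 mul0r addr0.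
  by apply: (mul_eq0 a0); rewrite -h34 h0 mulr0 subr0.
split=> //; split=> //.
  by rewrite -h23 b0 mul0r add0r.
by apply/eqP; rewrite -oppr_eq0 -h34 b0 mulr0 add0r.
Qed.

(** These are d1 + d2 = d3 and d1 + d3 = d4, read off from [f1,f2] and [f1,f3], with d_i the i-th
    diagonal entry of Ric^B minus [lam]. *)
Lemma soliton_derivation_diag (s := h1 ^+ 2 + h2 ^+ 2 + h3 ^+ 2 + h4 ^+ 2) :
  2 * lam = - 3 * a ^+ 2 - s + h1 ^+ 2 + h2 ^+ 2 - h3 ^+ 2 /\
  2 * lam = - 3 * c ^+ 2 - s + h1 ^+ 2 + h3 ^+ 2 - h4 ^+ 2.
Proof.
case: soliton_offdiag => _ _ _ [_ h23 h34 b0].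
split.
  apply/(mulfI a0); derive f3 f1 f2; rewrite h34 b0 /s => E; lra.
apply/(mulfI c0); derive f4 f1 f3; rewrite h23 h34 b0 /s => E; lra.
Qed.

Ltac laplace x y z :=
  have := HL x y z; rewrite /laplacian /ce_d2 !codiff_coor /rho;
  rewrite !HE /minor !coor_mu !coor_ricci_B !coor_frame.

(** The four frame components of the Laplace equation; the vanishing products h_i h_j remove the
    cross terms. *)
Lemma soliton_laplacian (s := h1 ^+ 2 + h2 ^+ 2 + h3 ^+ 2 + h4 ^+ 2) :
  [/\ 2 * lam * h1 = - (2 * s + h1 ^+ 2) * h1,
      2 * lam * h2 = - (c ^+ 2 + 2 * s + h2 ^+ 2) * h2,
      2 * lam * h3 = - (4 * a ^+ 2 + 2 * s + h3 ^+ 2) * h3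
    & 2 * lam * h4 = - (a ^+ 2 + 4 * c ^+ 2 + 2 * s + h4 ^+ 2) * h4].
Proof.
case: soliton_offdiag => h12 h13 h14 [h24 h23 h34 b0].
split.
- laplace f2 f3 f4; rewrite /s h12 h13 h14 h24 h23 h34 b0 => E; lra.
- laplace f1 f3 f4; rewrite /s h12 h13 h14 h24 h23 h34 b0 => E; lra.
- laplace f1 f2 f4; rewrite /s h12 h13 h14 h24 h23 h34 b0 => E; lra.
- laplace f1 f2 f3; rewrite /s h12 h13 h14 h24 h23 h34 b0 => E; lra.
Qed.

End Soliton.

End Frame.

Lemma soliton_parameters (R : realType) (a c h1 h2 h3 h4 lam : R)
    (s := h1 ^+ 2 + h2 ^+ 2 + h3 ^+ 2 + h4 ^+ 2) :
  0 < a -> 0 < c -> 0 < s ->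
  [/\ h1 * h2 = 0, h1 * h3 = 0 & h1 * h4 = 0] ->
  [/\ h2 * h4 = 0, h2 * h3 = 0 & h3 * h4 = 0] ->
  2 * lam = - 3 * a ^+ 2 - s + h1 ^+ 2 + h2 ^+ 2 - h3 ^+ 2 ->
  2 * lam = - 3 * c ^+ 2 - s + h1 ^+ 2 + h3 ^+ 2 - h4 ^+ 2 ->
  [/\ 2 * lam * h1 = - (2 * s + h1 ^+ 2) * h1,
      2 * lam * h2 = - (c ^+ 2 + 2 * s + h2 ^+ 2) * h2,
      2 * lam * h3 = - (4 * a ^+ 2 + 2 * s + h3 ^+ 2) * h3
    & 2 * lam * h4 = - (a ^+ 2 + 4 * c ^+ 2 + 2 * s + h4 ^+ 2) * h4] ->
  [/\ h2 = 0, h3 = 0, h4 = 0 & c = a /\ h1 ^+ 2 = a ^+ 2] \/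
  [/\ h1 = 0, h3 = 0, h4 = 0 & 4 * c ^+ 2 = 3 * a ^+ 2 /\ h2 ^+ 2 = c ^+ 2].
Proof.
rewrite {}/s => a_gt0 c_gt0 s_gt0 [h12 h13 h14] [h24 h23 h34].
move=> E1 E2 [L1 L2 L3 L4].
have a2 : 0 < a ^+ 2 by rewrite exprn_gt0.
have c2 : 0 < c ^+ 2 by rewrite exprn_gt0.
have zero (x y : R) : x != 0 -> x * y = 0 -> y = 0.
  by move=> x0 /eqP; rewrite mulf_eq0 (negPf x0) => /eqP.
have [h10|h1n] := eqVneq h1 0; last first.
  have h20 := zero _ _ h1n h12; have h30 := zero _ _ h1n h13.
  have h40 := zero _ _ h1n h14; left; split=> //; subst h2 h3 h4.
  have {}L1 := mulIf h1n L1.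
  (* Here [s = h1 ^+ 2], so the three expressions for [2 * lam] are -3 a^2, -3 c^2 and -3 h1^2. *)
  have ac : c ^+ 2 = a ^+ 2 by lra.
  split; last by lra.
  by apply/eqP; rewrite -(@eqrXn2 _ 2) ?ltW //; apply/eqP.
have [h20|h2n] := eqVneq h2 0; last first.
  have h30 := zero _ _ h2n h23; have h40 := zero _ _ h2n h24.
  right; split=> //; subst h1 h3 h4.
  have {}L2 := mulIf h2n L2.
  (* The three values of [2 * lam] are -3 a^2, -3 c^2 - h2^2 and -c^2 - 3 h2^2. *)
  by split; lra.
have [h30|h3n] := eqVneq h3 0; last first.
  have h40 := zero _ _ h3n h34; subst h1 h2 h4.
  (* Comparison with the first derivation equation gives a^2 + h3^2 = 0. *)
  have {}L3 := mulIf h3n L3; have := sqr_ge0 h3; lra.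
have [h40|h4n] := eqVneq h4 0; last first.
  (* Comparison with the second derivation equation gives a^2 + c^2 + h4^2 = 0. *)
  subst h1 h2 h3; have {}L4 := mulIf h4n L4; have := sqr_ge0 h4; lra.
by move: s_gt0; rewrite h10 h20 h30 h40 !expr0n !addr0 ltxx.
Qed.

(** * Gram-Schmidt orthonormalization along a flag *)

Section GramSchmidt.
Variables (R : realType) (V : vectType R) (g : {dot V for idfun}).
Implicit Types (s t : seq V).

Lemma dot_orthonormal_sum s (k : V -> R) u :
  orthonormal g s -> u \in s -> g (\sum_(x <- s) k x *: x) u = k u.
Proof.
elim: s => // x s IHs; rewrite orthonormal_cons => /and3P[/eqP gxx /allP gxs os].
rewrite inE big_cons dotDl dotZl => /predU1P[->|su]; last first.
  by rewrite (eqP (gxs _ su)) mulr0 add0r IHs.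
rewrite gxx mulr1 dot_suml big_seq big1 ?addr0 // => y /gxs /eqP gxy.
by rewrite dotZl dotC gxy mulr0.
Qed.

Lemma gram_schmidt_step s v : orthonormal g s -> v \notin <<s>>%VS ->
  exists k w, [/\ 0 < k, w \in <<s>>%VS & orthonormal g (k *: v + w :: s)].
Proof.
move=> os sv; pose p := \sum_(u <- s) g v u *: u.
have sp : p \in <<s>>%VS.
  by rewrite /p big_seq memv_suml // => u su; rewrite memvZ // memv_span.
have pu u : u \in s -> g (v - p) u = 0.
  by move=> su; rewrite dotDl dotNl (dot_orthonormal_sum _ os su) subrr.
have q0 : 0 < g (v - p) (v - p).
  apply: neq0_dnorm_gt0; apply: contra sv; rewrite subr_eq0 => /eqP->.
  exact: sp.
pose k := (Num.sqrt (g (v - p) (v - p)))^-1.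
have k0 : 0 < k by rewrite invr_gt0 sqrtr_gt0.
exists k, (- (k *: p)); split=> //; first by rewrite rpredN memvZ.
rewrite -scalerBr orthonormal_cons os andbT; apply/andP; split.
  rewrite dotZl dotZr mulrA -expr2 /k exprVn sqr_sqrtr ?ltW //.
  by rewrite mulVf // gt_eqF.
by apply/allP => u su; rewrite dotZl pu // mulr0.
Qed.

(** The list is processed from its end, so each new vector is corrected only by later ones. The
    positive leading coefficients are what makes [a] and [c] positive in [adapted_frame]. *)
Lemma gram_schmidt s : free s -> exists t,
  [/\ size t = size s, orthonormal g t, (<<t>> = <<s>>)%VS
    & forall i, (i < size s)%N ->
        exists2 k, 0 < k & t`_i - k *: s`_i \in <<drop i.+1 s>>%VS].
Proof.
elim: s => [|v s IHs]; first by exists [::]; split=> //.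
rewrite free_cons => /andP[sv /IHs[t [st ot tsE tP]]].
rewrite -tsE in sv; have [k [w [k0 tw okv]]] := gram_schmidt_step ot sv.
exists (k *: v + w :: t); split=> //=; first by rewrite st.
  rewrite !span_cons tsE; apply/eqP; rewrite eqEsubv !subv_add !addvSr !andbT.
  rewrite -!memvE; rewrite tsE in tw; apply/andP; split.
    by rewrite memv_add ?memvZ ?memv_line.
  have {1}-> : v = k^-1 *: (k *: v + w) - k^-1 *: w.
    by rewrite scalerDr addrK scalerA mulVf ?gt_eqF // scale1r.
  by rewrite memv_add ?memvZ ?memv_line // rpredN memvZ.
case=> [_|i /tP //]; exists k => //=.
by rewrite addrAC subrr add0r drop0 -tsE.
Qed.

End GramSchmidt.

(** * Alternating 3-forms in dimension four *)

Section Trilinear.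
Variables (R : realType) (V : vectType R).

(** Polarization of the two vanishing conditions in [is_three_form]. *)
Lemma three_form_alt (H : V -> V -> V -> R) : is_three_form H -> forall x y z,
  [/\ H y x z = - H x y z, H x z y = - H x y z & H x y x = 0].
Proof.
case=> Hl Hm Hr H1 H2 x y z.
have Dl u v y' z' : H (u + v) y' z' = H u y' z' + H v y' z'.
  by have := Hl y' z' 1 u v; rewrite scale1r mul1r.
have Dm x' u v z' : H x' (u + v) z' = H x' u z' + H x' v z'.
  by have := Hm x' z' 1 u v; rewrite scale1r mul1r.
have Dr x' y' u v : H x' y' (u + v) = H x' y' u + H x' y' v.
  by have := Hr x' y' 1 u v; rewrite scale1r mul1r.
have sw u v w : H v u w = - H u v w.
  by have := H1 (u + v) w; rewrite Dl !Dm !H1 add0r addr0 addrC => /eqP;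
    rewrite addr_eq0 => /eqP.
split=> //; last by rewrite sw H2 oppr0.
by have := H2 x (y + z); rewrite Dr !Dm !H2 add0r addr0 addrC => /eqP;
    rewrite addr_eq0 => /eqP->; rewrite opprK.
Qed.

Variables (g : {dot V for idfun}) (f1 f2 f3 f4 : V).
Hypothesis ob : orthonormal_basis g [:: f1; f2; f3; f4].

Lemma coor_inj x y : coor g f1 x = coor g f1 y -> coor g f2 x = coor g f2 y ->
  coor g f3 x = coor g f3 y -> coor g f4 x = coor g f4 y -> x = y.
Proof.
by move=> E1 E2 E3 E4; rewrite (frame_expand ob x) E1 E2 E3 E4 -frame_expand.
Qed.

Lemma three_form_frame (H : V -> V -> V -> R) : is_three_form H ->
  form_frame g f1 f2 f3 f4 H (H f2 f3 f4) (H f1 f3 f4) (H f1 f2 f4) (H f1 f2 f3).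
Proof.
move=> H3; have [Hl Hm Hr H1 H2] := H3.
have Hs x y z : H y x z = - H x y z by case: (three_form_alt H3 x y z).
have Ht x y z : H x z y = - H x y z by case: (three_form_alt H3 x y z).
have H13 x y : H x y x = 0 by case: (three_form_alt H3 x y x).
have El x y z : H x y z = coor g f1 x * H f1 y z + coor g f2 x * H f2 y z
                  + coor g f3 x * H f3 y z + coor g f4 x * H f4 y z.
  rewrite {1}(basis_expand x ob) (@linear_sumP _ _ R^o (fun x => H x y z)) //.
  by rewrite !big_cons big_nil addr0 !addrA.
have Em x y z : H x y z = coor g f1 y * H x f1 z + coor g f2 y * H x f2 z
                  + coor g f3 y * H x f3 z + coor g f4 y * H x f4 z.
  rewrite {1}(basis_expand y ob) (@linear_sumP _ _ R^o (fun y => H x y z)) //.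
  by rewrite !big_cons big_nil addr0 !addrA.
have Er x y z : H x y z = coor g f1 z * H x y f1 + coor g f2 z * H x y f2
                  + coor g f3 z * H x y f3 + coor g f4 z * H x y f4.
  rewrite {1}(basis_expand z ob) (@linear_sumP _ _ R^o (H x y)) //.
  by rewrite !big_cons big_nil addr0 !addrA.
move=> x y z; rewrite El !(Em _ y) !(Er _ _ z) !(H1, H2, H13).
(* Terms with a repeated index are gone. Swapping the first two slots, then the last two, then the
   first two again sorts every remaining index triple. *)
rewrite !(Hs f1 f2, Hs f1 f3, Hs f1 f4, Hs f2 f3, Hs f2 f4, Hs f3 f4).
rewrite !(Ht _ f1 f2, Ht _ f1 f3, Ht _ f1 f4, Ht _ f2 f3, Ht _ f2 f4, Ht _ f3 f4).
rewrite !(Hs f1 f2, Hs f1 f3, Hs f1 f4, Hs f2 f3, Hs f2 f4, Hs f3 f4).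
by rewrite /minor; ring.
Qed.

End Trilinear.

(** * Equivalences between triples with proportional structure constants *)

Section Equivalence.
Variables (R : realType) (V V' : vectType R).
Variables (mu : {bilinear V -> V -> V}) (g : {dot V for idfun}).
Variables (mu' : {bilinear V' -> V' -> V'}) (g' : {dot V' for idfun}).
Variables (f1 f2 f3 f4 : V) (f1' f2' f3' f4' : V').
Hypothesis ob : orthonormal_basis g [:: f1; f2; f3; f4].
Hypothesis ob' : orthonormal_basis g' [:: f1'; f2'; f3'; f4'].

(** The map is [r] times the isometry matching the frames. It scales the metric by [r ^+ 2];
    brackets are quadratic and 3-forms cubic in [r], which leaves one factor [r] in each condition
    on the constants. *)
Lemma frames_equivalent H H' a b c a' b' c' h1 h2 h3 h4 h1' h2' h3' h4' r eps :
  n4_frame mu g f1 f2 f3 f4 a b c -> n4_frame mu' g' f1' f2' f3' f4' a' b' c' ->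
  form_frame g f1 f2 f3 f4 H h1 h2 h3 h4 ->
  form_frame g' f1' f2' f3' f4' H' h1' h2' h3' h4' ->
  0 < r -> eps = 1 \/ eps = -1 -> [/\ a = r * a', b = r * b' & c = r * c'] ->
  [/\ r * h1' = eps * h1, r * h2' = eps * h2, r * h3' = eps * h3
    & r * h4' = eps * h4] ->
  equivalent_triples mu g H mu' g' H'.
Proof.
move=> muE muE' HE HE' r_gt0 epsE [aE bE cE] [E1 E2 E3 E4].
have r0 : r != 0 by rewrite gt_eqF.
pose phi0 x : V' := r *: (coor g f1 x *: f1' + coor g f2 x *: f2'
                          + coor g f3 x *: f3' + coor g f4 x *: f4').
have phiE x : (coor g' f1' (phi0 x) = r * coor g f1 x)
             * (coor g' f2' (phi0 x) = r * coor g f2 x)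
             * (coor g' f3' (phi0 x) = r * coor g f3 x)
             * (coor g' f4' (phi0 x) = r * coor g f4 x).
  by rewrite /phi0 !(coorD, coorZ) !(coor_frame ob'); do !split; ring.
clearbody phi0; have phi_lin : linear phi0.
  by move=> k x y; apply: (coor_inj ob'); rewrite !(coorD, coorZ) !phiE
    !(coorD, coorZ); ring.
pose phi : {linear V -> V'} :=
  HB.pack phi0 (GRing.isLinear.Build R V V' *:%R phi0 phi_lin).
exists phi, (r ^+ 2), eps; split.
- exists (fun y => r^-1 *: (coor g' f1' y *: f1 + coor g' f2' y *: f2
                          + coor g' f3' y *: f3 + coor g' f4' y *: f4)).
    move=> x /=; apply: (coor_inj ob); rewrite !(coorD, coorZ) !phiE
      !(coor_frame ob) !(mulr0, mulr1, addr0, add0r);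
    by rewrite mulKf.
  move=> y /=; apply: (coor_inj ob'); rewrite !phiE !(coorD, coorZ)
    !(coor_frame ob) !(mulr0, mulr1, addr0, add0r);
  by rewrite mulVKf.
- move=> x y /=; apply: (coor_inj ob'); rewrite !phiE
    !(coor_mu ob muE) !(coor_mu ob' muE') ?phiE ?aE ?bE ?cE; ring.
- by rewrite exprn_gt0.
- by move=> x y /=; rewrite (dot_coor ob) (dot_coor ob') !phiE; ring.
- move=> x y z /=.
  transitivity (r ^+ 2 *
    (r * h1' * minor g f2 f3 f4 x y z + r * h2' * minor g f1 f3 f4 x y z
     + r * h3' * minor g f1 f2 f4 x y z + r * h4' * minor g f1 f2 f3 x y z)).
    by rewrite HE' /minor !phiE; ring.
  by rewrite E1 E2 E3 E4 HE; ring.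
Qed.

End Equivalence.

(** * Existence of an adapted orthonormal frame *)

Section Adapted.
Variables (R : realType) (V : vectType R).
Variables (mu : {bilinear V -> V -> V}) (g : {dot V for idfun}).

Lemma adapted_frame : is_lie_bracket mu -> is_n4 mu ->
  exists f1 f2 f3 f4 a b c, [/\ orthonormal_basis g [:: f1; f2; f3; f4],
    n4_frame mu g f1 f2 f3 f4 a b c, 0 < a & 0 < c].
Proof.
move=> [alt _] [x1 [x2 [x3 [x4 [bx [m12 m13 m14 [m23 m24 m34]]]]]]].
have anti x y : mu y x = - mu x y.
  have := alt (x + y); rewrite !brE !alt add0r addr0 addrC => /eqP.
  by rewrite addr_eq0 => /eqP.
have [t [st ot tE tP]] := gram_schmidt g (basis_free bx).
case: t st ot tE tP => [|f1 [|f2 [|f3 [|f4 [|]]]]] //= _ of_ tE tP.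
have ob : orthonormal_basis g [:: f1; f2; f3; f4].
  split=> //; rewrite basisEdim tE (span_basis bx) subvv /=.
  by rewrite (size_basis bx).
(* The triangular expressions of f4, f3, f2, f1 in the x_i are read off in turn. *)
have [k4 k4_gt0 /= /[!span_nil] /[!memv0]] := tP 3%N isT.
rewrite subr_eq0 => /eqP f4E.
have [k3 k3_gt0 /= /[!span_seq1] /vlineP[p f3E]] := tP 2%N isT.
have [k2 k2_gt0 /= /[!span_cons] /[!span_nil] /[!addv0]] := tP 1%N isT.
case/memv_addP=> _ /vlineP[q ->] [_ /vlineP[r ->] f2E].
have [k1 k1_gt0 /= /[!span_cons] /[!span_nil] /[!addv0]] := tP 0%N isT.
case/memv_addP=> _ /vlineP[u ->].
case=> _ /memv_addP[_ /vlineP[v ->] [_ /vlineP[w ->] ->]] f1E.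
have {}f3E : f3 = k3 *: x3 + p *: x4 by rewrite -f3E addrC subrK.
have {}f2E : f2 = k2 *: x2 + (q *: x3 + r *: x4) by rewrite -f2E addrC subrK.
have {}f1E : f1 = k1 *: x1 + (u *: x2 + (v *: x3 + w *: x4)).
  by rewrite -f1E addrC subrK.
have k30 : k3 != 0 by rewrite gt_eqF.
have k40 : k4 != 0 by rewrite gt_eqF.
have x4E : x4 = k4^-1 *: f4 by rewrite f4E scalerA mulVf // scale1r.
have x3E : x3 = k3^-1 *: (f3 - (p * k4^-1) *: f4).
  by rewrite f3E -scalerA -x4E addrK scalerA mulVf // scale1r.
have mx := (m12, m13, m14, m23, m24, m34, alt, anti x1 x2, anti x1 x3,
  anti x1 x4, anti x2 x3, anti x2 x4, anti x3 x4).
(* [f1,f2] = k1 k2 x3 + k1 q x4 and [f1,f3] = k1 k3 x4; substituting x3 and x4 in terms of f3 and f4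
   gives [a], [b] and [c]. *)
pose a := k1 * k2 / k3; pose c := k1 * k3 / k4.
pose b := (k1 * q - k1 * k2 / k3 * p) / k4.
exists f1, f2, f3, f4, a, b, c; split=> //; last 2 first.
- by rewrite divr_gt0 ?mulr_gt0.
- by rewrite divr_gt0 ?mulr_gt0.
have f12 : mu f1 f2 = a *: f3 + b *: f4.
  rewrite {1}f1E {1}f2E !brE !mx x4E x3E.
  by apply: (coor_inj ob); rewrite !coorE !(coor_frame ob) /a /b; field;
    rewrite k30 k40.
have f13 : mu f1 f3 = c *: f4.
  rewrite {1}f1E {1}f3E !brE !mx x4E.
  by apply: (coor_inj ob); rewrite !coorE !(coor_frame ob) /c; field.
have f14 : mu f1 f4 = 0 by rewrite f1E f4E !brE !mx !(scaler0, addr0).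
have f23 : mu f2 f3 = 0.
  by rewrite f2E f3E !brE !mx !(oppr0, scaler0, addr0).
have f24 : mu f2 f4 = 0 by rewrite f2E f4E !brE !mx !(scaler0, addr0).
have f34 : mu f3 f4 = 0 by rewrite f3E f4E !brE !mx !(scaler0, addr0).
have mf := (f12, f13, f14, f23, f24, f34, alt, anti f1 f2, anti f1 f3,
  anti f1 f4, anti f2 f3, anti f2 f4, anti f3 f4).
move=> x y; rewrite {1}(frame_expand ob x) {1}(frame_expand ob y) !brE !mf.
by apply: (coor_inj ob);
  rewrite !coorE !(coor_frame ob); ring.
Qed.

End Adapted.

(** * Properties of the algebra and of the form read off from a frame *)

Section FrameAlgebra.
Variables (R : realType) (V : vectType R).
Variables (mu : {bilinear V -> V -> V}) (g : {dot V for idfun}).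
Variables (f1 f2 f3 f4 : V) (a b c : R).
Hypotheses (ob : orthonormal_basis g [:: f1; f2; f3; f4])
  (muE : n4_frame mu g f1 f2 f3 f4 a b c).

Lemma n4_frame_lie : is_lie_bracket mu.
Proof.
by split=> [x|x y z]; apply: (coor_inj ob);
  rewrite !(coorE, coor_mu ob muE); ring.
Qed.

Lemma lower_central_sub k (U : {vspace V}) :
  (forall x y, y \in lower_central mu k -> mu x y \in U) ->
  (lower_central mu k.+1 <= U)%VS.
Proof.
move=> sU; apply/span_subvP => _ /allpairsP[[x y] [_ /= /vbasis_mem yk ->]].
exact: sU.
Qed.

Lemma n4_frame_nilpotent : is_nilpotent mu.
Proof.
(* The lower central series is bounded by <f3, f4>, then <f4>, then 0. *)
exists 3%N; apply/eqP; rewrite -subv0; apply: lower_central_sub => x y.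
have /subvP L2 : (lower_central mu 2 <= <[f4]>)%VS.
  apply: lower_central_sub => {}x {}y.
  have /subvP L1 : (lower_central mu 1 <= <<[:: f3; f4]>>)%VS.
    apply: lower_central_sub => {}x {}y _; rewrite muE.
    by rewrite !(memvD, memvZ) // memv_span // !inE eqxx ?orbT.
  move=> /L1; rewrite span_cons span_seq1 => /memv_addP[_ /vlineP[k ->]].
  case=> _ /vlineP[l ->] ->; rewrite muE !coorE !(coor_frame ob).
  by rewrite !(mulr0, addr0, sub0r, oppr0, scale0r, add0r) memvZ ?memv_line.
move=> /L2 /vlineP[k ->]; rewrite memv0; apply/eqP/(coor_inj ob);
  by rewrite !(coor_mu ob muE, coorE, coor_frame ob); ring.
Qed.

(** The last two witnesses are forced: x3 = [f1,f2] and x4 = [f1,x3] = a c f4. *)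
Lemma n4_frame_n4 : a != 0 -> c != 0 -> is_n4 mu.
Proof.
move=> a0 c0; exists f1, f2, (a *: f3 + b *: f4), ((a * c) *: f4); split.
  rewrite basisEdim (size_basis ob.1) andbT; apply/subvP => x _.
  have -> : x = coor g f1 x *: f1 + coor g f2 x *: f2
    + (coor g f3 x / a) *: (a *: f3 + b *: f4)
    + ((coor g f4 x - b * coor g f3 x / a) / (a * c)) *: ((a * c) *: f4).
    by apply: (coor_inj ob); rewrite !coorE !(coor_frame ob);
      field; rewrite ?a0 ?c0.
  by rewrite !memvD // memvZ // memv_span // !inE eqxx ?orbT.
split; last split; apply: (coor_inj ob);
  by rewrite !(coor_mu ob muE, coorE, coor_frame ob); ring.
Qed.

(** A nilpotent algebra is unimodular, so its differential kills forms of degree one below the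
    top. *)
Lemma form_frame_closed H h1 h2 h3 h4 :
  form_frame g f1 f2 f3 f4 H h1 h2 h3 h4 ->
  forall x y z t, ce_d3 mu H x y z t = 0.
Proof.
by move=> HE x y z t; rewrite /ce_d3 !HE /minor !(coor_mu ob muE); ring.
Qed.

Lemma n4_frame_triple H h1 h2 h3 h4 :
  form_frame g f1 f2 f3 f4 H h1 h2 h3 h4 -> is_triple mu H.
Proof.
move=> HE; split; [exact: n4_frame_lie|exact: n4_frame_nilpotent| |].
  exact: form_frame_three_form HE.
exact: form_frame_closed HE.
Qed.

Lemma form_frame_non_classical H h1 h2 h3 h4 :
  form_frame g f1 f2 f3 f4 H h1 h2 h3 h4 ->
  0 < h1 ^+ 2 + h2 ^+ 2 + h3 ^+ 2 + h4 ^+ 2 <-> non_classical H.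
Proof.
move=> HE; split=> [h_gt0|[x [y [z Hn]]]].
  have [h10|h1n] := eqVneq h1 0; last first.
    by exists f2, f3, f4; rewrite HE /minor !(coor_frame ob); apply/eqP;
      apply: contra h1n => /eqP E; apply/eqP; lra.
  have [h20|h2n] := eqVneq h2 0; last first.
    by exists f1, f3, f4; rewrite HE /minor !(coor_frame ob); apply/eqP;
      apply: contra h2n => /eqP E; apply/eqP; lra.
  have [h30|h3n] := eqVneq h3 0; last first.
    by exists f1, f2, f4; rewrite HE /minor !(coor_frame ob); apply/eqP;
      apply: contra h3n => /eqP E; apply/eqP; lra.
  exists f1, f2, f3; rewrite HE /minor !(coor_frame ob) => E.
  have h40 : h4 = 0 by lra.
  move: h_gt0; rewrite h10 h20 h30 h40 expr0n /= !addr0.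
  by rewrite ltxx.
have := sqr_ge0 h1; have := sqr_ge0 h2; have := sqr_ge0 h3; have := sqr_ge0 h4.
move=> p4 p3 p2 p1; rewrite lt0r !addr_ge0 // andbT.
apply/negP; rewrite !paddr_eq0 ?addr_ge0 // !sqrf_eq0.
case/andP=> /andP[/andP[/eqP h10 /eqP h20] /eqP h30] /eqP h40.
by apply: Hn; rewrite HE h10 h20 h30 h40 !mul0r !addr0.
Qed.

End FrameAlgebra.

(** * The two models on R^4 *)

Section Standard.
Variable R : realType.
Local Notation e k := (evec R k).
Local Notation co k := (coor (@std_metric R) (e k)).

Lemma coor_std k x : co k x = ecov k x.
Proof.
rewrite /coor /= /std_dot (bigD1 (inord k.-1)) //= big1 ?addr0 => [|i ik].
  by rewrite mxE !eqxx mulr1.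
by rewrite mxE (negPf ik) andbF mulr0.
Qed.

Lemma inord_eq (i j : nat) : (i < 4)%N -> (j < 4)%N ->
  (inord i == inord j :> 'I_4) = (i == j).
Proof. by move=> i4 j4; rewrite -val_eqE /= !inordK. Qed.

Lemma std_basis : orthonormal_basis (@std_metric R) [:: e 1; e 2; e 3; e 4].
Proof.
have E i j : (i < 4)%N -> (j < 4)%N ->
    std_metric (e i.+1) (e j.+1) = (i == j)%:R.
  move=> i4 j4; have /= -> := coor_std j.+1 (e i.+1).
  by rewrite /ecov mxE eqxx inord_eq // eq_sym.
split; last by rewrite !orthonormal_cons /= !E /= ?eqxx.
rewrite basisEdim dimvf /= andbT; apply/subvP => x _.
have -> : x = \sum_(i < 4) x 0 i *: e i.+1.
  rewrite {1}(row_sum_delta x); apply: eq_bigr => i _.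
  by rewrite /evec inord_val.
by apply: memv_suml => -[[|[|[|[|//]]]] Hi] _;
  rewrite memvZ // memv_span // !inE eqxx ?orbT.
Qed.

Lemma n4_bracket_frame (c : R) :
  n4_frame (n4_bracket c) (@std_metric R) (e 1) (e 2) (e 3) (e 4) 1 0 c.
Proof.
move=> x y; rewrite !coor_std /n4_bracket /ecov2 /= scale1r scale0r addr0.
by rewrite (mulrC c).
Qed.

Lemma ecov3E i j k (x y z : 'rV[R]_4) :
  ecov3 i j k x y z = minor (@std_metric R) (e i) (e j) (e k) x y z.
Proof.
rewrite /minor !coor_std /ecov3 (expand_det_row _ ord0) !big_ord_recl big_ord0.
rewrite /cofactor !(expand_det_row _ ord0) !big_ord_recl !big_ord0 /cofactor.
rewrite !det_mx11 !mxE /=.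
rewrite /bump /= !add0n; ring.
Qed.

Lemma model1_form_frame :
  form_frame std_metric (e 1) (e 2) (e 3) (e 4) model1_form
    0 (Num.sqrt 3 / 2) 0 0.
Proof. by move=> x y z; rewrite /model1_form ecov3E; ring. Qed.

Lemma model2_form_frame :
  form_frame std_metric (e 1) (e 2) (e 3) (e 4) model2_form 1 0 0 0.
Proof. by move=> x y z; rewrite /model2_form ecov3E; ring. Qed.

Lemma coor_diag4 d1 d2 d3 d4 x :
  (co 1 (diag4 d1 d2 d3 d4 x) = d1 * co 1 x) *
  (co 2 (diag4 d1 d2 d3 d4 x) = d2 * co 2 x) *
  (co 3 (diag4 d1 d2 d3 d4 x) = d3 * co 3 x) *
  (co 4 (diag4 d1 d2 d3 d4 x) = d4 * co 4 x).
Proof.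
rewrite /diag4 -!coor_std; set x1 := co 1 x; set x2 := co 2 x.
set x3 := co 3 x; set x4 := co 4 x.
by rewrite !coorE !(coor_frame std_basis); do !split; ring.
Qed.

Lemma diag4_linear d1 d2 d3 d4 : linear (@diag4 R d1 d2 d3 d4).
Proof.
by move=> k x y; apply: (coor_inj std_basis); rewrite !(coor_diag4, coorE);
  ring.
Qed.

(** The weights of e3 and e4 are dictated by e3 = [e1,e2] and c e4 = [e1,e3]. *)
Lemma diag4_derivation c d1 d2 :
  is_derivation (n4_bracket c) (@diag4 R d1 d2 (d1 + d2) (d1 + d1 + d2)).
Proof.
have mE := coor_mu std_basis (n4_bracket_frame c).
split=> [|x y]; first exact: diag4_linear.
by apply: (coor_inj std_basis); rewrite coorD coor_diag4 !mE ?coor_diag4; ring.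
Qed.

Lemma sqr_half_sqrt3 : (Num.sqrt 3 / 2 : R) ^+ 2 = 3 / 4.
Proof. by rewrite expr_div_n sqr_sqrtr //; field. Qed.

Lemma model1_soliton :
  nilsoliton_with model1_bracket std_metric (@model1_form R)
    (- (3 / 2)) (diag4 (1 / 4) 1 (5 / 4) (3 / 2)).
Proof.
split.
  have := diag4_derivation (Num.sqrt 3 / 2) (1 / 4) 1.
  have -> : 1 / 4 + 1 = 5 / 4 :> R by field.
  by have -> : 1 / 4 + 1 / 4 + 1 = 3 / 2 :> R by field.
rewrite /model1_bracket.
have HE := model1_form_frame; have c2 := sqr_half_sqrt3.
(* The square root is hidden behind [c]; the remaining identities use only [c ^+ 2 = 3 / 4]. *)
set c := Num.sqrt 3 / 2 in HE c2 *; have muE := n4_bracket_frame c.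
exists [:: e 1; e 2; e 3; e 4]; split; first exact: std_basis.
  by move=> x; apply: (coor_inj std_basis);
    rewrite !(coor_ricci_B std_basis muE HE) coorD coorZ coor_diag4 c2; field.
apply: (form_frame_laplacian std_basis muE HE) => //; first exact: mul0r.
  by field.
by rewrite c2; field.
Qed.

Lemma model2_soliton :
  nilsoliton_with model2_bracket std_metric (@model2_form R)
    (- (3 / 2)) (diag4 (1 / 2) (1 / 2) 1 (3 / 2)).
Proof.
split.
  have := diag4_derivation 1 (1 / 2) (1 / 2).
  have -> : 1 / 2 + 1 / 2 = 1 :> R by field.
  by have -> : 1 + 1 / 2 = 3 / 2 :> R by field.
have muE := n4_bracket_frame 1.
exists [:: e 1; e 2; e 3; e 4]; split; first exact: std_basis.
  by move=> x; apply: (coor_inj std_basis);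
    rewrite !(coor_ricci_B std_basis muE model2_form_frame) coorD coorZ coor_diag4;
    field.
apply: (form_frame_laplacian std_basis muE model2_form_frame) => //.
- exact: mulr0.
- by field.
- by field.
Qed.

(** An isomorphism [phi] sends e3 into <e3, e4> and e4 into <e4>, as these are brackets, and e2 into
    <e2, e3, e4>. So the second form on the images of e2, e3, e4 is a triangular determinant,
    nonzero by injectivity, whereas the first form vanishes on e2, e3, e4. *)
Lemma models_not_equivalent :
  ~ equivalent_triples model1_bracket std_metric (@model1_form R)
      model2_bracket std_metric (@model2_form R).
Proof.
set c : R := Num.sqrt 3 / 2.
have c0 : c != 0 by rewrite /c mulf_neq0 ?invr_neq0 ?gt_eqF ?sqrtr_gt0.
have ob := std_basis; have mu1 := n4_bracket_frame c.
have mu2 := n4_bracket_frame 1.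
case=> phi [r [eps [[psi phiK _] phiM _ _ phiH]]].
have := phiH (e 2) (e 3) (e 4); rewrite model1_form_frame model2_form_frame.
rewrite /minor !(coor_frame ob).
have f12 : n4_bracket c (e 1) (e 2) = e 3.
  by apply: (coor_inj ob); rewrite !(coor_mu ob mu1) !(coor_frame ob); ring.
have f13 : n4_bracket c (e 1) (e 3) = c *: e 4.
  by apply: (coor_inj ob);
    rewrite !(coor_mu ob mu1) !coorE !(coor_frame ob); ring.
have f23 : n4_bracket c (e 2) (e 3) = 0.
  by apply: (coor_inj ob);
    rewrite !(coor_mu ob mu1, coor_frame ob, coor0); ring.
have p12 : phi (e 3) = n4_bracket 1 (phi (e 1)) (phi (e 2)).
  by rewrite -f12; exact: phiM.
have p13 : c *: phi (e 4) = n4_bracket 1 (phi (e 1)) (phi (e 3)).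
  by rewrite -linearZ -f13; exact: phiM.
have p23 : 0 = n4_bracket 1 (phi (e 2)) (phi (e 3)).
  by rewrite -(linear0 phi) -f23; exact: phiM.
have u1 : co 1 (phi (e 3)) = 0 by rewrite p12 !(coor_mu ob mu2).
have u2 : co 2 (phi (e 3)) = 0 by rewrite p12 !(coor_mu ob mu2).
have u3 : co 3 (phi (e 3)) = co 1 (phi (e 1)) * co 2 (phi (e 2))
    - co 2 (phi (e 1)) * co 1 (phi (e 2)).
  by rewrite {1}p12 !(coor_mu ob mu2) mul1r.
have E4 k : c * co k (phi (e 4)) = co k (n4_bracket 1 (phi (e 1)) (phi (e 3))).
  by rewrite -coorZ p13.
have w1 : co 1 (phi (e 4)) = 0.
  by apply: (mulfI c0); rewrite E4 !(coor_mu ob mu2) mulr0.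
have w2 : co 2 (phi (e 4)) = 0.
  by apply: (mulfI c0); rewrite E4 !(coor_mu ob mu2) mulr0.
have w3 : co 3 (phi (e 4)) = 0.
  by apply: (mulfI c0); rewrite E4 !(coor_mu ob mu2) u1 u2; ring.
have w4 : c * co 4 (phi (e 4)) = co 1 (phi (e 1)) * co 3 (phi (e 3)).
  by rewrite E4 !(coor_mu ob mu2) u1 u2; ring.
have w0 : co 4 (phi (e 4)) != 0.
  apply/eqP => w40.
  have phi0 : phi (e 4) = 0.
    by apply: (coor_inj ob); rewrite ?w1 ?w2 ?w3 ?w40 !coorE.
  have /(congr1 (coor std_metric (e 4))) : e 4 = 0.
    by rewrite -(phiK (e 4)) phi0 -[RHS]phiK linear0.
  by rewrite !coorE !(coor_frame ob) => /eqP; rewrite oner_eq0.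
have pu0 : co 1 (phi (e 1)) * co 3 (phi (e 3)) != 0 by rewrite -w4 mulf_neq0.
have u0 : co 3 (phi (e 3)) != 0 by apply: contraNneq pu0 => ->; rewrite mulr0.
(* The e4 component of [phi e2, phi e3] = 0 is the product of this coordinate with the nonzero e3
   coordinate of phi e3. *)
have q1 : co 1 (phi (e 2)) = 0.
  have := congr1 (coor std_metric (e 4)) p23.
  rewrite !(coor_mu ob mu2) coor0 u1 => E.
  by apply: (mulIf u0); rewrite mul0r; lra.
(* The determinant is now the product of its diagonal entries, so the e2 coordinate of phi e2
   vanishes; by [u3] the e3 coordinate of phi e3 would then vanish too. *)
rewrite u1 u2 w1 w2 w3 => E.
have q2 : co 2 (phi (e 2)) = 0.
  by apply: (mulIf (mulf_neq0 u0 w0)); rewrite mul0r; lra.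
by move: u0; rewrite u3 q1 q2 !mulr0 subr0 eqxx.
Qed.

End Standard.

(** * Classification up to equivalence *)

Theorem proposition10p3 (R : realType) :
  (* (1) and (2) are non-classical generalized nilsolitons on n_4, with the
     given constants *)
  [/\ is_triple model1_bracket (@model1_form R),
      is_n4 (@model1_bracket R),
      non_classical (@model1_form R)
    & nilsoliton_with model1_bracket std_metric (@model1_form R)
        (- (3 / 2)) (diag4 (1 / 4) 1 (5 / 4) (3 / 2))] /\
  [/\ is_triple model2_bracket (@model2_form R),
      is_n4 (@model2_bracket R),
      non_classical (@model2_form R)
    & nilsoliton_with model2_bracket std_metric (@model2_form R)
        (- (3 / 2)) (diag4 (1 / 2) (1 / 2) 1 (3 / 2))] /\
  (* they are distinct up to equivalence *)
  ~ equivalent_triples model1_bracket std_metric (@model1_form R)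
      model2_bracket std_metric (@model2_form R) /\
  (* and there are no others *)
  (forall (V : vectType R) (mu : {bilinear V -> V -> V})
      (g : {dot V for idfun}) (H : V -> V -> V -> R),
    is_triple mu H -> is_n4 mu -> non_classical H ->
    generalized_nilsoliton mu g H ->
    equivalent_triples mu g H model1_bracket std_metric model1_form \/
    equivalent_triples mu g H model2_bracket std_metric model2_form).
Proof.
have ob := std_basis R; have F := @n4_bracket_frame R.
have c_gt0 : 0 < Num.sqrt 3 / 2 :> R by rewrite divr_gt0 ?sqrtr_gt0.
have c2 := sqr_half_sqrt3 R.
have HE1 := @model1_form_frame R; have HE2 := @model2_form_frame R.
split; [|split; [|split; first exact: models_not_equivalent]].
- split; first exact: (n4_frame_triple ob (F _) HE1).
  + by apply: (n4_frame_n4 ob (F _)); rewrite ?oner_eq0 ?gt_eqF.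
  + by apply/(form_frame_non_classical ob HE1); rewrite c2; lra.
  + exact: model1_soliton.
- split; first exact: (n4_frame_triple ob (F _) HE2).
  + by apply: (n4_frame_n4 ob (F _)); rewrite ?oner_eq0.
  + by apply/(form_frame_non_classical ob HE2); lra.
  + exact: model2_soliton.
move=> V mu g H [lie _ H3 _] n4 Hn0 [lam [D [[_ HD] [e' [ob' HR HL]]]]].
have [f1 [f2 [f3 [f4 [a [b [c [of_ muE a_gt0 cc_gt0]]]]]]]]
  := adapted_frame g lie n4.
have a0 : a != 0 by rewrite gt_eqF.
have c0 : c != 0 by rewrite gt_eqF.
have HE := three_form_frame of_ H3.
(* The soliton equations pass from the given basis [e'] to the adapted frame. *)
rewrite (ricci_B_indep mu ob' of_ H3) in HR HL.
rewrite (laplacian_indep mu ob' of_ H3) in HL.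
have s_gt0 := (form_frame_non_classical of_ HE).2 Hn0.
have [h12 h13 h14 [h24 h23 h34 b0]] := soliton_offdiag of_ muE HE HD HR a0 c0.
have [E1 E2] := soliton_derivation_diag of_ muE HE HD HR a0 c0.
have L := soliton_laplacian of_ muE HE HD HR HL a0 c0.
have sign (x y : R) : x ^+ 2 = y ^+ 2 ->
    exists eps, (eps = 1 \/ eps = -1) /\ x = eps * y.
  move/eqP; rewrite eqf_sqr => /orP[] /eqP ->.
    by exists 1; split; [left | rewrite mul1r].
  by exists (-1); split; [right | rewrite mulN1r].
case: (soliton_parameters a_gt0 cc_gt0 s_gt0 _ _ E1 E2 L) => // -[h'].
- move=> h3 h4 [ca h1]; right.
  (* Scaling by [r = a] normalizes [f1,f2] to e3, and [eps] absorbs the undetermined sign of the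
     form. *)
  have [eps [eps1 aE]] := sign _ _ (esym h1).
  apply: (frames_equivalent of_ ob muE (F 1) HE HE2 a_gt0 eps1).
    by rewrite b0 ca; split; ring.
  by rewrite h' h3 h4 -aE; split; ring.
- move=> h3 h4 [ca h2]; left.
  have [eps [eps1 cE]] := sign _ _ (esym h2).
  (* The positive root of 4 c^2 = 3 a^2; this produces the constant of the first model. *)
  have caE : c = a * (Num.sqrt 3 / 2).
    apply/eqP; rewrite -(@eqrXn2 R 2 _ _ isT (ltW cc_gt0)
                              (ltW (mulr_gt0 a_gt0 c_gt0))).
    by rewrite exprMn c2; apply/eqP; lra.
  apply: (frames_equivalent of_ ob muE (F _) HE HE1 a_gt0 eps1).
    by rewrite b0 -caE; split; ring.
  by rewrite h' h3 h4 -cE caE; split; ring.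
Qed.
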